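(* Let $X$ be a set with $|X|\ge 3$ and let $n\ge 2$ be an integer. Every operation in $\mathcal{F}^n_{n-1}$ is reducible to a binary associative operation.
   Context: An operation $F\colon X^n\to X$ is associative if $F(x_1,\ldots,x_{i-1},F(x_i,\ldots,x_{i+n-1}),x_{i+n},\ldots,x_{2n-1})=F(x_1,\ldots,x_i,F(x_{i+1},\ldots,x_{i+n}),x_{i+n+1},\ldots,x_{2n-1})$ for all $x_1,\ldots,x_{2n-1}\in X$ and $1\le i\le n-1$. $\mathcal{F}^n_{n-1}$ is the class of associative operations $F\colon X^n\to X$ such that $F(x_1,\ldots,x_n)\in\{x_1,\ldots,x_n\}$ whenever at least $n-1$ of the components $x_1,\ldots,x_n$ are equal to each other. For a binary associative $G\colon X^2\to X$, define $G^1=G$ and $G^m(x_1,\ldots,x_{m+1})=G^{m-1}(x_1,\ldots,x_{m-1},G(x_m,x_{m+1}))$ for $m\ge 2$. An operation $F\colon X^n\to X$ is reducible to $G$ if $F=G^{n-1}$. *)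

(* Defs.v *)
From mathcomp Require Import all_boot.

Set Implicit Arguments.
Unset Strict Implicit.
Unset Printing Implicit Defensive.

(* Indices start at 0, so x_1, ..., x_k is written x 0, ..., x k.-1.
   A list of variables of X is the initial segment of a stream x : nat -> X;
   the later terms of the stream are never read, and every nonempty tuple is
   such a segment, so quantifying over streams is quantifying over tuples. *)

(* The value of F on the tuple obtained from x 0, ..., x (2n-2) by replacing
   the block of length n that starts at index i by its image under F. *)
Definition nested (X : Type) (n : nat) (F : n.-tuple X -> X)
    (x : nat -> X) (i : nat) : X :=
  F [tuple if j < i then x j
           else if j == i :> nat then F [tuple x (i + k) | k < n]
           else x (j + n.-1) | j < n].

Definition nary_associative (X : Type) (n : nat) (F : n.-tuple X -> X) : Prop :=
  forall (x : nat -> X) (i : nat), i.+1 < n -> nested F x i = nested F x i.+1.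

Definition at_least_equal (X : Type) (n k : nat) (x : n.-tuple X) : Prop :=
  exists2 A : {set 'I_n}, k <= #|A| &
    forall i j, i \in A -> j \in A -> tnth x i = tnth x j.

(* The class F^n_k; [exists i] says that F x is one of the components of x. *)
Definition class_F (X : Type) (n k : nat) (F : n.-tuple X -> X) : Prop :=
  nary_associative F /\
  forall x : n.-tuple X, at_least_equal k x -> exists i, F x = tnth x i.

(* G^m, of arity m + 1. Setting G^0 to be the identity makes the recursion
   give G^1 = G by computation. *)
Fixpoint op_power (X : Type) (G : X -> X -> X) (m : nat) (x : nat -> X) : X :=
  if m is m'.+1 then
    op_power G m' (fun j => if j < m' then x j else G (x m') (x m'.+1))
  else x 0.

Definition reducible_to (X : Type) (n : nat) (F : n.-tuple X -> X)
    (G : X -> X -> X) : Prop :=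
  forall x : nat -> X, F [tuple x j | j < n] = op_power G n.-1 x.

(* Main.v *)
(** Write n = m + 1, and read words over X in the covering semigroup of F, in
   which any n consecutive letters may be replaced by their image under F.  For
   x <> y the class condition puts x^i y x^(m-i) in {x, y}, so x^m y and y x^m lie
   in {x, y}.
   If some letter a satisfies a^m x = x = x a^m for all x, then a commutes with
   every letter and G x y := x a^(m-1) y reduces F.
   Otherwise no two distinct letters can fix each other in this sense: if x and
   y did and x^m z = x for some z <> x, then y^m z = y^m x^m z = y^m x = x would
   not be in {y, z}.  A case analysis then gives x^m y = x y^m for all x, y, and
   G x y := x^m y reduces F. *)
Require Import Defs.
From mathcomp Require Import all_boot.
From mathcomp Require Import zify.
From Stdlib Require Import Classical Setoid Morphisms.

(** * Evaluation of long words *)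

Section Words.

Set Implicit Arguments.
Unset Strict Implicit.
Unset Printing Implicit Defensive.

Variables (X : Type) (x0 : X) (m : nat) (F : m.+1.-tuple X -> X).
Hypothesis F_assoc : nary_associative F.

(* Only meaningful on words of length m.+1: a shorter word is padded with x0,
   a longer one is truncated. *)
Definition word_op (s : seq X) : X := F [tuple nth x0 s j | j < m.+1].

Lemma word_op_mkseq (x : nat -> X) :
  word_op (mkseq x m.+1) = F [tuple x j | j < m.+1].
Proof.
congr (F _); apply: eq_from_tnth => j.
by rewrite !tnth_mktuple nth_mkseq.
Qed.

Lemma word_op_cat (s t : seq X) : m < size s -> word_op (s ++ t) = word_op s.
Proof.
move=> hs; congr (F _); apply: eq_from_tnth => j.
by rewrite !tnth_mktuple nth_cat (leq_trans (ltn_ord j)).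
Qed.

Lemma nested_nth (u v w : seq X) : size u <= m -> size v = m.+1 ->
  nested F (nth x0 (u ++ v ++ w)) (size u) = word_op (u ++ word_op v :: w).
Proof.
move=> hu hv; congr (F _); apply: eq_from_tnth => j.
rewrite !tnth_mktuple [RHS]nth_cat.
case: (ltngtP j (size u)) => hj.
- by rewrite nth_cat hj.
- have -> : j - size u = (j - (size u).+1).+1 by lia.
  rewrite /= nth_cat ifF; last by lia.
  by rewrite nth_cat hv ifF; [congr nth; lia | lia].
- rewrite hj subnn /=; congr (F _); apply: eq_from_tnth => k.
  by rewrite !tnth_mktuple nth_cat ltnNge leq_addr /= addKn nth_cat hv ltn_ord.
Qed.

Lemma nested_shift (x : nat -> X) (i : nat) : i <= m -> nested F x i = nested F x 0.
Proof. by elim: i => // i IHi hi; rewrite -F_assoc // IHi // ltnW. Qed.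

(** Left-bracketed evaluation; the fuel [k] is exact for words of length [k * m + 1]. *)
Fixpoint eval_steps (k : nat) (s : seq X) : X :=
  if k is k'.+1 then eval_steps k' (word_op s :: drop m.+1 s) else head x0 s.

Lemma eval_stepsS (k : nat) (s : seq X) :
  eval_steps k.+1 s = eval_steps k (word_op s :: drop m.+1 s).
Proof. by []. Qed.

(** If [v] starts within the first [m.+1] letters, associativity slides the inner application of [F]
    to the front, where evaluation starts. If it starts later, the first evaluation step only
    touches [u], and induction applies to the rest. *)
Lemma eval_steps_contract (k : nat) (u v w : seq X) :
  size v = m.+1 -> size (u ++ v ++ w) = (k.+1 * m).+1 ->
  eval_steps k.+1 (u ++ v ++ w) = eval_steps k (u ++ word_op v :: w).
Proof.
elim: k u v w => [|k IHk] u v w hv; rewrite !size_cat hv => hs.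
  have /nilP -> : nilp u by rewrite /nilp; lia.
  have /nilP -> : nilp w by rewrite /nilp; lia.
  by rewrite cats0.
case: (leqP (size u) m) => hu.
  have := nested_shift (nth x0 (u ++ v ++ w)) hu; rewrite nested_nth // => E.
  set s := u ++ v ++ w in E *.
  have hsz : size (take m.+1 s) = m.+1 by rewrite size_take !size_cat hv; case: ifP; lia.
  have := @nested_nth [::] (take m.+1 s) (drop m.+1 s) isT hsz.
  rewrite cat0s cat_take_drop /= -E => {}E.
  have -> : word_op s = word_op (take m.+1 s).
    by rewrite -{1}(cat_take_drop m.+1 s) word_op_cat ?hsz.
  rewrite -E /=; congr (eval_steps k (_ :: _)).
  rewrite drop_drop /s !drop_cat hv.
  rewrite !ifF; try lia.
  rewrite (_ : m.+1 - size u = (m - size u).+1) /=; last by lia.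
  by congr drop; lia.
rewrite [LHS]eval_stepsS [RHS]eval_stepsS !word_op_cat // !drop_cat.
case: (ltngtP (size u) m.+1) hu => // hu _; last first.
  rewrite hu subnn !drop0.
  by rewrite hv; apply: (IHk [:: word_op u]) => //; rewrite !size_cat /= hv; lia.
apply: (IHk (word_op u :: drop m.+1 u)) => //.
by rewrite !size_cat /= size_drop hv; lia.
Qed.

(** * The covering semigroup as a congruence on words *)

Definition eval (s : seq X) : X := eval_steps ((size s).-1 %/ m) s.

(* Equality in the covering semigroup, tested in the contexts where evaluation
   is defined, i.e. those completing the word to a length congruent to 1. *)
Definition eqw (u v : seq X) : Prop :=
  size u = size v %[mod m] /\
  forall p q, size (p ++ u ++ q) = 1 %[mod m] ->
    eval (p ++ u ++ q) = eval (p ++ v ++ q).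

#[local] Infix "~~~" := eqw (at level 70).

Lemma size_cat_modn (p u v q : seq X) : size u = size v %[mod m] ->
  size (p ++ u ++ q) = size (p ++ v ++ q) %[mod m].
Proof.
by move=> h; apply/eqP; rewrite !size_cat eqn_modDl eqn_modDr; apply/eqP.
Qed.

#[local] Instance eqw_equivalence : Equivalence eqw.
Proof.
split.
- by move=> u; split.
- move=> u v [huv h]; split=> // p q hs; apply/esym/h.
  by rewrite (size_cat_modn p q huv).
- move=> u v w [huv h] [hvw h']; split=> [|p q hs]; first by rewrite huv.
  by rewrite h // h' // -(size_cat_modn p q huv).
Qed.

#[local] Instance cat_eqw : Proper (eqw ==> eqw ==> eqw) cat.
Proof.
move=> u u' [hu h] v v' [hv h']; split=> [|p q].
  by rewrite (size_cat_modn [::] v hu) -(cats0 v) -(cats0 v') (size_cat_modn u' [::] hv).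
rewrite -!catA => hs; rewrite h // !(catA p) h' // -!catA.
by rewrite -(size_cat_modn p (v ++ q) hu).
Qed.

Hypothesis m_gt0 : 0 < m.

Lemma eqw_contract (s : seq X) : size s = m.+1 -> s ~~~ [:: word_op s].
Proof.
move=> hs; split=> [|p q]; first by rewrite hs -addn1 modnDl.
rewrite /eval !size_cat hs /= => /eqP; rewrite eqn_mod_dvd; last by lia.
move=> /dvdnP [[|k] hk]; first by lia.
rewrite (_ : (_ + (_ + _)).-1 = k.+1 * m); last by lia.
rewrite (_ : (_ + _).-1 = k * m); last by lia.
rewrite !mulnK //; apply: eval_steps_contract => //.
by rewrite !size_cat hs; lia.
Qed.

(** The empty context evaluates a one-letter word to its letter, so identities in [X] can be proved
    by computing with words. *)
Lemma eqw_letter (x y : X) : [:: x] ~~~ [:: y] -> x = y.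
Proof. by move=> [_ /(_ [::] [::] erefl)]; rewrite /eval /= div0n. Qed.

(** * The class condition on words *)

Hypothesis F_class : forall x : m.+1.-tuple X,
  at_least_equal m x -> exists i, F x = tnth x i.

Lemma word_op_insert (a b : nat) (x y : X) : a + b = m ->
  word_op (nseq a x ++ y :: nseq b x) = x \/
  word_op (nseq a x ++ y :: nseq b x) = y.
Proof.
move=> hab; have ha : a < m.+1 by lia.
set s := nseq a x ++ _.
have nth_s (j : 'I_m.+1) : nth x0 s j = if j == Ordinal ha then y else x.
  rewrite -val_eqE /= /s nth_cat size_nseq nth_nseq.
  case: ltngtP => [//|hj|->]; last by rewrite subnn.
  have -> : j - a = (j - a.+1).+1 by lia.
  by rewrite /= nth_nseq ifT //; have := ltn_ord j; lia.
rewrite /word_op; have [|i ->] := F_class (x := [tuple nth x0 s j | j < m.+1]).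
  (* The [m] positions other than [a] all hold [x]. *)
  exists (~: [set Ordinal ha]); first by rewrite cardsC1 card_ord.
  move=> i j; rewrite !inE => /negPf hi /negPf hj.
  by rewrite !tnth_mktuple !nth_s hi hj.
by rewrite tnth_mktuple nth_s; case: ifP; [right | left].
Qed.

Lemma eqw_insert (a b : nat) (x y : X) : a + b = m ->
  nseq a x ++ [:: y] ++ nseq b x ~~~ [:: x] \/
  nseq a x ++ [:: y] ++ nseq b x ~~~ [:: y].
Proof.
move=> hab.
have h : nseq a x ++ [:: y] ++ nseq b x ~~~ [:: word_op (nseq a x ++ y :: nseq b x)].
  by apply: eqw_contract; rewrite !size_cat !size_nseq /=; lia.
by case: (word_op_insert x y hab) => E; rewrite E in h; [left | right].
Qed.

Local Notation e x := (nseq m x).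

Lemma eqw_lmul (x y : X) : e x ++ [:: y] ~~~ [:: x] \/ e x ++ [:: y] ~~~ [:: y].
Proof. exact: eqw_insert (addn0 m). Qed.

Lemma eqw_rmul (x y : X) : [:: y] ++ e x ~~~ [:: x] \/ [:: y] ++ e x ~~~ [:: y].
Proof. exact: eqw_insert (add0n m). Qed.

Lemma eqw_idem_l (x : X) : e x ++ [:: x] ~~~ [:: x].
Proof. by case: (eqw_lmul x x). Qed.

Lemma eqw_idem_r (x : X) : [:: x] ++ e x ~~~ [:: x].
Proof. by case: (eqw_rmul x x). Qed.

Definition fixes (x y : X) : Prop :=
  e x ++ [:: y] ~~~ [:: y] /\ [:: y] ++ e x ~~~ [:: y].

Lemma nseq_headE (x : X) : e x = [:: x] ++ nseq m.-1 x.
Proof. by rewrite -{1}(prednK m_gt0). Qed.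

Lemma nseq_lastE (x : X) : e x = nseq m.-1 x ++ [:: x].
Proof. by rewrite -[[:: x]]/(nseq 1 x) -nseqD addn1 prednK. Qed.

Lemma fixes_of_mutual (x y : X) : x <> y -> fixes x y -> fixes y x ->
  forall z, fixes x z.
Proof.
move=> hxy [exy yex] [eyx xey] z; split.
- case: (eqw_lmul x z) => // exz.
  have eyz : e y ++ [:: z] ~~~ [:: x].
    have -> : e y ++ [:: z] ~~~ e y ++ e x ++ [:: z].
      by rewrite nseq_lastE -!catA (catA [:: y]) yex.
    by rewrite exz eyx.
  (* Now [x] is [y], which is excluded, or [z], which makes the goal an instance of idempotence. *)
  case: (eqw_lmul y z); rewrite eyz => /eqw_letter // h.
  by rewrite -h eqw_idem_l.
- case: (eqw_rmul x z) => // zex.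
  have zey : [:: z] ++ e y ~~~ [:: x].
    have -> : [:: z] ++ e y ~~~ ([:: z] ++ e x) ++ e y.
      by rewrite (nseq_headE y) -!catA (catA (e x)) exy.
    by rewrite zex xey.
  case: (eqw_rmul y z); rewrite zey => /eqw_letter // h.
  by rewrite -h eqw_idem_r.
Qed.

(** * Reduction through a neutral letter *)

Section Neutral.

Variable a : X.
Hypothesis a_neutral : forall x, fixes a x.

(** Write [a x = a x a^m = (a x a^(m-1)) a]. The bracket is [x], as wanted, or [a]; in that case
    [a x = a a], so [x = a^m x = a^m a = a]. *)
Lemma neutral_comm (x : X) : [:: a] ++ [:: x] ~~~ [:: x] ++ [:: a].
Proof.
have hm : 1 + m.-1 = m by rewrite add1n prednK.
have axa : [:: a] ++ [:: x] ~~~ ([:: a] ++ [:: x] ++ nseq m.-1 a) ++ [:: a].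
  by rewrite -!catA -nseq_lastE; have [_ ->] := a_neutral x.
case: (eqw_insert a x hm) => h; rewrite axa h //.
have [] := a_neutral x; rewrite (nseq_lastE a) -catA axa h catA -nseq_lastE.
by rewrite eqw_idem_l => /eqw_letter ->.
Qed.

Lemma neutral_comm_nseq (k : nat) (x : X) :
  nseq k a ++ [:: x] ~~~ [:: x] ++ nseq k a.
Proof.
elim: k => [//|k IHk].
by rewrite -[nseq _ a]/([:: a] ++ nseq k a) -catA IHk catA neutral_comm -catA.
Qed.

Lemma neutral_nseq_mul (k : nat) (x : X) : [:: x] ++ nseq (k * m) a ~~~ [:: x].
Proof.
elim: k => [//|k IHk].
by rewrite mulSn nseqD catA; have [_ ->] := a_neutral x.
Qed.

Definition neutral_op (x y : X) : X := word_op ([:: x] ++ nseq m.-1 a ++ [:: y]).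

Lemma neutral_opE (x y : X) :
  [:: neutral_op x y] ~~~ [:: x] ++ nseq m.-1 a ++ [:: y].
Proof.
symmetry; apply: eqw_contract.
by rewrite !size_cat size_nseq /= add1n addn1 prednK.
Qed.

Lemma neutral_opA : associative neutral_op.
Proof. by move=> x y z; apply: eqw_letter; rewrite !neutral_opE -!catA. Qed.

(** Each product leaves [m.-1] letters [a], which commute to the end. For [k = m] they form [m.-1]
    copies of [a^m] and are absorbed. *)
Lemma op_power_neutral (k : nat) (x : nat -> X) :
  [:: op_power neutral_op k x] ~~~ mkseq x k.+1 ++ nseq (k * m.-1) a.
Proof.
elim: k x => [//|k IHk] x.
rewrite [op_power _ _ _]/= IHk !mkseqS ltnn -!cats1 -!catA.
have -> : mkseq (fun j => if j < k then x j else neutral_op (x k) (x k.+1)) k =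
          mkseq x k.
  by apply/eq_in_map => j; rewrite mem_iota => /andP[_ ->].
by rewrite neutral_opE mulSn nseqD -!catA (catA (nseq _ a)) neutral_comm_nseq -!catA.
Qed.

End Neutral.

(** * Reduction without a neutral letter *)

Section NoNeutral.

Hypothesis no_neutral : forall x, ~ forall y, fixes x y.

(** If [x y^m = y], then [x^m y = x^m x y^m = x y^m]. If [x y^m = x = x^m y], nothing is left to
    prove. *)
Lemma eqw_swap (x y : X) : e x ++ [:: y] ~~~ [:: x] ++ e y.
Proof.
case: (eqw_rmul y x) => xey.
  by rewrite -xey catA eqw_idem_l.
case: (eqw_lmul x y) => exy; first by rewrite exy xey.
(* Here [x y^m = x] and [x^m y = y]. If [y x^m = x], then [y y = y x^m y = x y], so
   [y = y y^m = x y^m = x]; [y^m x = y] is dual. Otherwise [x] and [y] fix each other. *)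
suff -> : x = y by rewrite eqw_idem_l eqw_idem_r.
case: (eqw_rmul x y) => yex.
  have yy : [:: y] ++ [:: y] ~~~ [:: x] ++ [:: y] by rewrite -{2}exy catA yex.
  by apply: eqw_letter; rewrite -(eqw_idem_r y) nseq_headE catA yy -catA -nseq_headE xey.
case: (eqw_lmul y x) => eyx.
  have xx : [:: x] ++ [:: x] ~~~ [:: x] ++ [:: y] by rewrite -{1}xey -catA eyx.
  by apply: eqw_letter; rewrite -(eqw_idem_l x) nseq_lastE -catA xx catA -nseq_lastE exy.
apply: NNPP => hxy; apply: (no_neutral (x := x)).
exact: (@fixes_of_mutual x y).
Qed.

Definition quasi_op (x y : X) : X := word_op (e x ++ [:: y]).

Lemma quasi_opE (x y : X) : [:: quasi_op x y] ~~~ e x ++ [:: y].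
Proof. by symmetry; apply: eqw_contract; rewrite size_cat size_nseq addn1. Qed.

(** Swapping replaces the [m] copies of the inner product by a single one; both sides then become
    [x^m y z^m]. *)
Lemma quasi_opA : associative quasi_op.
Proof.
move=> x y z; apply: eqw_letter.
by rewrite !quasi_opE (eqw_swap (quasi_op x y)) quasi_opE -catA eqw_swap.
Qed.

Lemma op_power_quasi (k : nat) (x : nat -> X) :
  [:: op_power quasi_op k x] ~~~
  flatten [seq e (x j) | j <- iota 0 k] ++ [:: x k].
Proof.
elim: k x => [//|k IHk] x.
rewrite [op_power _ _ _]/= IHk ltnn quasi_opE -addn1 iotaD map_cat flatten_cat.
have -> : [seq e (if j < k then x j else quasi_op (x k) (x (k + 1))) | j <- iota 0 k] =
          [seq e (x j) | j <- iota 0 k].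
  by apply/eq_in_map => j; rewrite mem_iota => /andP[_ ->].
by rewrite /= cats0 add0n addn1 -catA.
Qed.

Lemma eqw_nseq_shift (k : nat) (x y : X) :
  nseq k.+1 x ++ [:: y] ~~~ e x ++ nseq k.+2 y.
Proof.
elim: k => [|k IHk].
  rewrite -[nseq 2 y]/([:: y] ++ [:: y]) catA eqw_swap -catA.
  by rewrite eqw_idem_l.
rewrite -[nseq k.+2 x]/([:: x] ++ nseq k.+1 x) -catA IHk catA eqw_idem_r.
rewrite -[nseq k.+3 y]/([:: y] ++ nseq k.+2 y) catA eqw_swap -catA.
by rewrite -[nseq k.+2 y]/([:: y] ++ nseq k.+1 y) (catA (e y)) eqw_idem_l.
Qed.

(** The surplus exponent is carried to the last letter; for [k = m] it is [m.+1], and idempotence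
    leaves the word of [op_power_quasi]. *)
Lemma mkseq_quasi (k : nat) (x : nat -> X) :
  mkseq x k.+1 ~~~ flatten [seq e (x j) | j <- iota 0 k] ++ nseq k.+1 (x k).
Proof.
elim: k => [//|k IHk].
rewrite mkseqS -cats1 IHk -catA eqw_nseq_shift.
by rewrite -[in iota 0 k.+1]addn1 iotaD map_cat flatten_cat /= cats0 add0n -catA.
Qed.

End NoNeutral.

Lemma reducible_of_class : exists G : X -> X -> X, associative G /\ reducible_to F G.
Proof.
case: (classic (exists a, forall x, fixes a x)) => [[a a_neutral]|no].
  exists (neutral_op a); split=> [|x]; first exact: neutral_opA.
  rewrite -word_op_mkseq; apply: eqw_letter.
  rewrite op_power_neutral // -eqw_contract ?size_mkseq //.
  by rewrite mkseqS -cats1 -catA mulnC neutral_nseq_mul.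
have {}no : forall x, ~ forall y, fixes x y by move=> x hx; apply: no; exists x.
exists quasi_op; split=> [|x]; first exact: quasi_opA.
rewrite -word_op_mkseq; apply: eqw_letter.
rewrite op_power_quasi -eqw_contract ?size_mkseq // mkseq_quasi //.
by rewrite -[nseq m.+1 _]/([:: x m] ++ e (x m)) eqw_idem_r.
Qed.

End Words.

Theorem corollary1p7 (X : Type)
    (hX : exists a b c : X, a <> b /\ a <> c /\ b <> c)
    (n : nat) (hn : 2 <= n)
    (F : n.-tuple X -> X) (hF : class_F n.-1 F) :
  exists G : X -> X -> X, associative G /\ reducible_to F G.
Proof.
case: hX => x0 _; case: n hn F hF => // m hm F [F_assoc F_class].
exact: (reducible_of_class x0 F_assoc hm F_class).
Qed.
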